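(* There exists a constant $c>0$ such that the following holds. Let $n,d,m,t,N$ be positive integers. Every algebraic coloring of $K_N$ of complexity $(n,d,m)$ with $t$ colors contains a monochromatic clique of size at least $c'N^{1/\gamma}$, where $c'=c'(n,d,m)>0$ and $$\gamma=c\,n\,m\,\min\left\{d,\frac{n\log d}{\log n}\right\}.$$
   Context: Here $[t]=\{1,\dots,t\}$ and $K_N$ is the complete graph on $N$ vertices. A coloring $\chi:E(K_N)\to[t]$ of the edges of $K_N$ with $t$ colors is algebraic of complexity $(n,d,m)$ if the vertices of $K_N$ are elements of $\mathbb{F}^n$ for some field $\mathbb{F}$, and there exist $m$ polynomials $f_1,\dots,f_m:(\mathbb{F}^n)^2\to\mathbb{F}$ of degree at most $d$ and a function $\phi:\{\text{false},\text{true}\}^m\to[t]$ such that $\chi(\mathbf{u},\mathbf{v})=\phi([f_1(\mathbf{u},\mathbf{v})=0],\dots,[f_m(\mathbf{u},\mathbf{v})=0])$ for all pairs of distinct vertices $\mathbf{u},\mathbf{v}$. A monochromatic clique is a set of vertices all of whose pairs receive the same color.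
   Formalization: When d = 1 or n = 1 the displayed formula is undefined (γ = 0 for d = 1 < n, division by log 1 = 0 for n = 1); in these cases the minimum is read as d, so that γ = c·n·m·d. *)

(* Defs.v *)
From HB Require Import structures.
From mathcomp Require Import all_boot all_order all_algebra.
From mathcomp Require mpoly.

Set Implicit Arguments.
Unset Strict Implicit.
Unset Printing Implicit Defensive.

Import Order.TTheory GRing.Theory Num.Theory.
Local Open Scope ring_scope.

(* The edges of K_N are the two-element sets of vertices; the values of a
   coloring on other sets are irrelevant. *)
Definition edge_coloring (N t : nat) := {set 'I_N} -> 'I_t.

Definition monochromatic_clique (N t : nat) (chi : edge_coloring N t)
    (S : {set 'I_N}) : Prop :=
  exists k : 'I_t,
    forall u v : 'I_N, u \in S -> v \in S -> u != v -> chi [set u; v] = k.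

(* The multinomials notations clash with those of mathcomp-analysis, so they
   are imported only inside this module. *)
Module AlgebraicColoring.
Import mpoly.

(* A polynomial on (F^n)^2 has n + n variables: the coordinates of the first
   point, followed by those of the second. *)
Definition eval2 (F : fieldType) (n : nat) (f : {mpoly F[n + n]})
    (x y : 'rV[F]_n) : F :=
  f.@[fun i => row_mx x y 0 i].

(* [pt] identifies the vertices with distinct elements of F^n. As msize is one
   more than the total degree (and 0 for the zero polynomial), the bound
   d.+1 expresses degree at most d. *)
Definition algebraic (n d m N t : nat) (chi : edge_coloring N t) : Prop :=
  exists (F : fieldType) (pt : 'I_N -> 'rV[F]_n)
         (f : 'I_m -> {mpoly F[n + n]}) (phi : {ffun 'I_m -> bool} -> 'I_t),
    [/\ injective pt,
        forall i, (msize (f i) <= d.+1)%N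
      & forall u v : 'I_N, u != v ->
          chi [set u; v] = phi [ffun i => eval2 (f i) (pt u) (pt v) == 0]].

End AlgebraicColoring.
Export AlgebraicColoring.

From mathcomp Require Import reals exp.

(* min {d, n log d / log n}. The quotient is read as +oo when n = 1. When
   d = 1 < n the literal minimum would be 0, leaving N^(1/gamma) undefined;
   the minimum is then read as d = 1, as it would be with log (d + 1) in place
   of log d, a change that for d >= 2 only affects the constant c. *)
Definition min_exponent (R : realType) (n d : nat) : R :=
  if (n == 1)%N || (d == 1)%N then d%:R
  else Num.min d%:R (n%:R * ln d%:R / ln n%:R).

(* Main.v *)
Require Import Defs.
From mathcomp Require Import all_boot all_order all_algebra.
From mathcomp Require Import boolp reals exp.
From mathcomp Require Import zify lra.

Set Implicit Arguments.
Unset Strict Implicit.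
Unset Printing Implicit Defensive.

Import Order.TTheory GRing.Theory Num.Theory.
Import (canonicals) mpoly.
Local Open Scope ring_scope.

(** Since the constant may depend on [n], [d] and [m], a clique of size
    proportional to [N `^ (1 / (n + 1))] is enough: [min_exponent R n d] is at
    least [1 / 2], so that [c = 4] gives [gamma >= 2 * n * m >= n + 1]
    ([min_exponent_ge_half]).

    Such a clique is found by lowering the dimension of a set [X] of vertices.
    Suppose that [X] is dense in an irreducible variety. Each function
    [f_i (u, _)] either vanishes on [X] or cuts it in a set of smaller
    dimension. If one of these cuts contains a proportion [1 / r] of [X], pass
    to an irreducible piece of it. If none does, keep the vertices [u] having
    the most frequent set of indices [i] for which [f_i (u, _)] vanishes on
    [X]. Among them a zero pattern is exceptional for few pairs, and a greedy
    choice gives about [r] vertices without exceptional pairs, which form a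
    clique ([descend_or_homogeneous]). As the dimension can be lowered at most
    [n] times, [r] can be taken of the order of [N `^ (1 / (n + 1))].

    Irreducibility matters here only for functions of bounded degree on a
    finite set of points, and is taken to mean that the product of two
    functions of degree at most [s] is zero on [X] only if one of the factors
    is. If this fails, [X] is covered by two
    zero sets on which the space of functions of degree [s] has a smaller
    dimension, so that boundedly many halvings lead to an irreducible set
    ([irreducible_subset]). The dimension of a variety is replaced by the
    length of a flag of irreducible sets. On an irreducible set multiplication
    by a function that is not zero on it is injective, which bounds the Hilbert
    function from below ([hilbert_hypersurface]): a flag of length [k] gives at
    least [binomial (j + k, k)] independent functions of degree [j * d]
    ([flag_hilbert]). There are at most [(j * d + 1) ^ n] of them, hence
    [k <= n] when [j] is large ([no_long_flag]). *)

(** * Polynomial functions on a finite set of points *)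

Section PolynomialFunctions.

Variables (F : fieldType) (n N : nat) (pt : 'I_N -> 'rV[F]_n).
Implicit Types (X Y : {set 'I_N}) (g h : 'rV[F]_N).

(** Functions on the points are row vectors indexed by the points; the rows of
    this matrix are the monomials of degree at most [s] in each coordinate.
    Bounding the partial degrees rather than the total degree makes the number
    of monomials [(s + 1) ^ n], and bounds still add up under products. *)
Definition monomials (s : nat) :
    'M[F]_(#|{ffun 'I_n -> 'I_s.+1}|, N) :=
  \matrix_(a, x) \prod_i pt x 0 i ^+ (enum_val a : {ffun 'I_n -> 'I_s.+1}) i.

Definition polyfun (s : nat) (g : 'rV[F]_N) := (g <= monomials s)%MS.

Definition vanishes (X : {set 'I_N}) (g : 'rV[F]_N) :=
  [forall x in X, g 0 x == 0].

(** Right multiplication by this matrix extends the restriction to [X] by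
    zero; right multiplication by [diag_mx g] is the pointwise product by
    [g]. *)
Definition restrict (X : {set 'I_N}) : 'M[F]_N :=
  diag_mx (\row_x (x \in X)%:R).

(** The Hilbert function of the point set [X], for partial degrees. *)
Definition hilbert (s : nat) (X : {set 'I_N}) : nat :=
  \rank (monomials s *m restrict X).

Lemma vanishesE X g : vanishes X g = (g *m restrict X == 0).
Proof.
rewrite /restrict mul_mx_diag; apply/idP/eqP.
  move=> /forall_inP gX; apply/rowP => x; rewrite !mxE.
  by case: (boolP (x \in X)) => xX; rewrite ?mulr0 // (eqP (gX x xX)) mul0r.
move=> /rowP gX; apply/forall_inP => x xX.
by have := gX x; rewrite !mxE xX mulr1 => ->.
Qed.

Lemma vanishesS X Y g : Y \subset X -> vanishes X g -> vanishes Y g.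
Proof.
move=> /subsetP sYX /forall_inP gX; apply/forall_inP => x xY.
exact/gX/sYX.
Qed.

Lemma mulmx_restrict m X Y (A : 'M[F]_(m, N)) : Y \subset X ->
  A *m restrict X *m restrict Y = A *m restrict Y.
Proof.
move=> /subsetP sYX; rewrite -mulmxA mulmx_diag; congr (_ *m diag_mx _).
apply/rowP => x; rewrite !mxE.
by case: (boolP (x \in Y)) => [/sYX ->|_]; rewrite ?mulr1 // mulr0.
Qed.

Lemma polyfun_monomial s (e : 'I_n -> nat) : (forall i, (e i <= s)%N) ->
  polyfun s (\row_x \prod_i pt x 0 i ^+ e i).
Proof.
move=> es; pose a := [ffun i => inord (e i) : 'I_s.+1].
rewrite /polyfun (_ : \row_x _ = row (enum_rank a) (monomials s)) ?row_sub //.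
apply/rowP => x; rewrite !mxE enum_rankK; apply: eq_bigr => i _.
by rewrite ffunE inordK // ltnS.
Qed.

Lemma polyfunD s g h : polyfun s g -> polyfun s h -> polyfun s (g + h).
Proof. exact: addmx_sub. Qed.

Lemma polyfunZ s a g : polyfun s g -> polyfun s (a *: g).
Proof. exact: scalemx_sub. Qed.

Lemma monomials_mul s d g : polyfun d g ->
  (monomials s *m diag_mx g <= monomials (s + d))%MS.
Proof.
move=> /submxP[c ->]; apply/row_subP => a.
have -> : row a (monomials s *m diag_mx (c *m monomials d)) =
          c *m (monomials d *m diag_mx (row a (monomials s))).
  apply/rowP => x; rewrite mul_mx_diag !mxE big_distrr /=; apply: eq_bigr => b _.
  by rewrite mul_mx_diag !mxE mulrCA; congr (_ * _); rewrite mulrC.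
apply: mulmx_sub; apply/row_subP => b.
have -> : row b (monomials d *m diag_mx (row a (monomials s))) =
    \row_x \prod_i pt x 0 i ^+ (enum_val a i + enum_val b i)%N.
  apply/rowP => x; rewrite mul_mx_diag !mxE -big_split /=.
  by apply: eq_bigr => i _; rewrite exprD mulrC.
by apply: polyfun_monomial => i; apply: leq_add; rewrite -ltnS.
Qed.

Lemma polyfunW s s' g : (s <= s')%N -> polyfun s g -> polyfun s' g.
Proof.
move=> ss' /submx_trans; apply; apply/row_subP => a.
rewrite (_ : row a _ = \row_x \prod_i pt x 0 i ^+ enum_val a i); last first.
  by apply/rowP => x; rewrite !mxE.
by apply: polyfun_monomial => i; apply: leq_trans ss'; rewrite -ltnS.
Qed.

Lemma hilbert_le s X : (hilbert s X <= s.+1 ^ n)%N.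
Proof.
by apply: leq_trans (rank_leq_row _) _; rewrite card_ffun !card_ord.
Qed.

(** The constant function 1 does not vanish on [X]. *)
Lemma hilbert_gt0 s X : X != set0 -> (0 < hilbert s X)%N.
Proof.
move=> /set0Pn[x xX]; rewrite lt0n mxrank_eq0; apply/eqP => P0.
have : polyfun s (\row_x \prod_i pt x 0 i ^+ 0) by exact: polyfun_monomial.
move=> /(submxMr (restrict X)); rewrite P0 => /submx0null /eqP.
rewrite -vanishesE => /forall_inP/(_ x xX); rewrite mxE big1 ?oner_eq0 //.
Qed.

(** The kernel of the restriction from [X] to [Y], on functions of degree
    [s], accounts for the drop of the Hilbert function. *)
Lemma hilbert_restrict s X Y : Y \subset X ->
  (hilbert s Y +
   \rank ((monomials s *m restrict X) :&: kermx (restrict Y)))%N = hilbert s X.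
Proof. by move=> sYX; rewrite /hilbert -(mulmx_restrict _ sYX) mxrank_mul_ker. Qed.

Lemma hilbert_lt s X Y g : Y \subset X -> polyfun s g ->
  vanishes Y g -> ~~ vanishes X g -> (hilbert s Y < hilbert s X)%N.
Proof.
move=> sYX Pg gY gX; rewrite -(hilbert_restrict s sYX) -[ltnLHS]addn0 ltn_add2l.
rewrite lt0n mxrank_eq0; apply/eqP => K0.
move: gX; rewrite vanishesE => /negP; apply; apply/eqP.
apply: (@submx0null _ _ N); rewrite -K0 sub_capmx submxMr //=.
by apply/sub_kermxP; rewrite mulmx_restrict //; apply/eqP; rewrite -vanishesE.
Qed.

(** * Irreducibility up to a given degree *)

Definition irreducible (s : nat) (X : {set 'I_N}) : Prop :=
  forall g h : 'rV[F]_N, polyfun s g -> polyfun s h ->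
  vanishes X (h *m diag_mx g) -> vanishes X g \/ vanishes X h.

(** If [X] is reducible, then it is covered by two zero sets on which the
    Hilbert function is smaller; repeat with the larger one. The Hilbert
    function is at most the number of monomials, which bounds the number of
    halvings independently of the number of points. *)
Lemma irreducible_subset s X :
  exists Y : {set 'I_N},
    [/\ Y \subset X, irreducible s Y & (#|X| <= 2 ^ (s.+1 ^ n) * #|Y|)%N].
Proof.
suff [Y [sYX irrY leXY]] : exists Y : {set 'I_N},
    [/\ Y \subset X, irreducible s Y & (#|X| <= 2 ^ hilbert s X * #|Y|)%N].
  exists Y; split=> //; apply: leq_trans leXY _.
  by rewrite leq_mul2r leq_exp2l ?hilbert_le ?orbT.
have [k] := ubnP (hilbert s X); elim: k X => // k IHk X hk.
have [irrX|] := EM (irreducible s X).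
  by exists X; split=> //; rewrite leq_pmull ?expn_gt0.
move=> /existsNP[g /existsNP[h /not_implyP[Pg /not_implyP[Ph]]]].
move=> /not_implyP[ghX /not_orP[/negP gX /negP hX]].
pose Z f := [set x in X | (f : 'rV[F]_N) 0 x == 0].
have split_half f : polyfun s f -> ~~ vanishes X f -> (#|X| <= 2 * #|Z f|)%N ->
    exists Y : {set 'I_N},
    [/\ Y \subset X, irreducible s Y & (#|X| <= 2 ^ hilbert s X * #|Y|)%N].
  move=> Pf fX leXZ.
  have sZX : Z f \subset X by apply/subsetP => x; rewrite inE => /andP[].
  have fZ : vanishes (Z f) f by apply/forall_inP => x; rewrite inE => /andP[].
  have ltZX := hilbert_lt sZX Pf fZ fX.
  have [|Y [sYZ irrY leZY]] := IHk (Z f); first exact: leq_trans ltZX _.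
  exists Y; split=> //; first exact: subset_trans sYZ sZX.
  apply: leq_trans leXZ _; apply: (@leq_trans (2 * (2 ^ hilbert s (Z f) * #|Y|))).
    by rewrite leq_mul2l leZY orbT.
  by rewrite mulnA -expnS leq_mul2r leq_exp2l // ltZX orbT.
have : (#|X| <= #|Z g| + #|Z h|)%N.
  apply: leq_trans (leq_card_setU _ _); apply/subset_leq_card/subsetP => x xX.
  have := forall_inP ghX x xX.
  by rewrite mul_mx_diag !mxE mulf_eq0 !inE xX /= orbC.
have [leZ leX|ltZ leX] := leqP #|Z g| #|Z h|.
  by apply: (split_half h) => //; lia.
by apply: (split_half g) => //; lia.
Qed.

(** On an irreducible [X], multiplication by a function [g] that does not
    vanish identically is injective, and its image lies in the kernel of the
    restriction to [Y] if [g] vanishes there. *)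
Lemma hilbert_hypersurface s s' d X Y g :
  Y \subset X -> irreducible s' X -> (s <= s')%N -> (d <= s')%N ->
  polyfun d g -> vanishes Y g -> ~~ vanishes X g ->
  (hilbert (s + d) Y + hilbert s X <= hilbert (s + d) X)%N.
Proof.
move=> sYX irrX ss' ds' Pg gY gX.
rewrite -(hilbert_restrict (s + d) sYX) leq_add2l.
set Q := monomials s *m restrict X.
have <- : \rank (Q *m diag_mx g) = hilbert s X.
  rewrite -[RHS](mxrank_mul_ker Q (diag_mx g)).
  suff -> : (Q :&: kermx (diag_mx g))%MS = 0 by rewrite mxrank0 addn0.
  apply/eqP/rowV0P => v; rewrite sub_capmx => /andP[/submxP[c ->] /sub_kermxP].
  rewrite mulmxA => gQ0; apply/eqP; rewrite -vanishesE.
  have Pc : polyfun s' (c *m monomials s).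
    exact: polyfunW ss' (submxMl _ _).
  have [|gX'|//] := irrX _ _ (polyfunW ds' Pg) Pc.
    by rewrite vanishesE -mulmxA diag_mxC mulmxA; apply/eqP.
  by rewrite gX' in gX.
apply: mxrankS; rewrite sub_capmx; apply/andP; split.
  by rewrite -mulmxA diag_mxC mulmxA submxMr // monomials_mul.
apply/sub_kermxP; rewrite -mulmxA (_ : diag_mx g *m _ = 0) ?mulmx0 //.
apply/eqP/rowV0P => v /submxP[c ->].
rewrite /restrict mulmxA mul_mx_diag mul_mx_diag; apply/rowP => x; rewrite !mxE.
case: (boolP (x \in Y)) => xY; last by rewrite mulr0.
by rewrite (eqP (forall_inP gY x xY)) mulr0 mul0r.
Qed.

(** A flag of length [k] is a strictly decreasing chain of nonempty irreducible
    sets below [X], each cut out of the previous one by a function of degree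
    [d]; it stands for the assertion that the dimension of [X] is at least
    [k]. *)
Fixpoint flag (s d k : nat) (X : {set 'I_N}) : Prop :=
  [/\ X != set0, irreducible s X &
      if k is k'.+1 then
        exists (Y : {set 'I_N}) (g : 'rV[F]_N),
          [/\ Y \subset X, polyfun d g, vanishes Y g, ~~ vanishes X g &
              flag s d k' Y]
      else True].

(** The recursion for the Hilbert function on both sides is that of Pascal's
    triangle: the set [X] has at least as many functions of degree [j * d] as
    affine [k]-space has of degree [j]. *)
Lemma flag_hilbert s d k j X :
  flag s d k X -> (j * d <= s)%N -> ('C(j + k, k) <= hilbert (j * d) X)%N.
Proof.
elim: k j X => [|k IHk] j X /= [X0 irrX].
  by move=> _ _; rewrite bin0 hilbert_gt0.
move=> [Y [g [sYX Pg gY gX flagY]]]; elim: j => [|j IHj] jds.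
  by rewrite add0n binn hilbert_gt0.
rewrite addSn binS addnC -{1}addSnnS.
have jds' : (j * d <= s)%N by apply: leq_trans jds; rewrite leq_mul2r leqnSn orbT.
have ds : (d <= s)%N by apply: leq_trans jds; rewrite leq_pmull.
apply: leq_trans (leq_add (IHk j.+1 Y flagY jds) (IHj jds')) _.
rewrite mulSn (addnC d).
exact: hilbert_hypersurface sYX irrX jds' ds Pg gY gX.
Qed.

(** This is [j * d] for [j = (n + 1)! * d ^ n], which is large enough for
    [(j * d + 1) ^ n <= d ^ n * (j + 1) ^ n < (j + 1) ^ (n + 1) / (n + 1)!],
    where the last term is a lower bound for [binomial (j + n + 1, n + 1)]. *)
Definition flag_degree (d : nat) : nat := (n.+1)`! * d ^ n * d.

Lemma flag_degree_ge d : (0 < d)%N -> (d <= flag_degree d)%N.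
Proof. by move=> d0; rewrite leq_pmull // muln_gt0 fact_gt0 expn_gt0 d0. Qed.

Lemma bin_lower_bound j k : (j.+1 ^ k <= 'C(j + k, k) * k`!)%N.
Proof.
rewrite bin_ffact; elim: k => [|k IHk]; first by rewrite expn0 ffactn0.
by rewrite expnS addnS ffactnS /= leq_mul // ltnS leq_addr.
Qed.

(** A flag of length [n + 1] would carry too many independent functions: their
    number grows as [j ^ (n + 1)], that of the monomials as [j ^ n]. *)
Lemma no_long_flag d X : (0 < d)%N -> ~ flag (flag_degree d) d n.+1 X.
Proof.
move=> d0 flagX; pose j := ((n.+1)`! * d ^ n)%N.
have := leq_trans (flag_hilbert (j := j) flagX (leqnn _)) (hilbert_le _ _).
apply/negP; rewrite -ltnNge -(ltn_pmul2r (fact_gt0 n.+1)).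
apply: leq_trans (bin_lower_bound j n.+1).
have le1 : ((j * d).+1 ^ n <= (j.+1 * d) ^ n)%N.
  by case: (n) => [|n'] //; rewrite leq_exp2r // mulSn; lia.
apply: leq_ltn_trans (leq_mul le1 (leqnn _)) _.
rewrite expnMn expnS -mulnA mulnC ltn_pmul2r ?expn_gt0 //.
by rewrite /j mulnC ltnS.
Qed.

End PolynomialFunctions.

(** * Large homogeneous sets *)

Lemma popular_value (T A : finType) (k : T -> A) (X : {set T}) : X != set0 ->
  exists p, (#|X| <= #|A| * #|[set x in X | k x == p]|)%N.
Proof.
move=> /set0Pn[x0 _]; pose C p := #|[set x in X | k x == p]|.
have [p _ maxp] := @arg_maxnP A (k x0) xpredT C isT.
exists p; rewrite -sum1_card (partition_big k xpredT) //= -sum_nat_const.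
apply: leq_sum => q _; apply: leq_trans (maxp q isT).
by rewrite /C -sum1_card; apply/eq_leq/eq_bigl => x; rewrite inE.
Qed.

(** Greedy choice: keep a point and discard its out-neighbours. As only one of
    the two directions has to be avoided, bounding the out-degrees suffices. *)
Lemma sparse_independent_set (T : finType) (bad : rel T) (D : nat)
    (X : {set T}) :
  (forall u, u \in X -> (#|[set v in X | bad u v]| <= D)%N) ->
  exists S : {set T}, [/\ S \subset X, (#|X| <= D.+1 * #|S|)%N &
    {in S &, forall u v, u != v -> ~~ bad u v || ~~ bad v u}].
Proof.
have [k] := ubnP #|X|; elim: k X => // k IHk X leXk badX.
have [->|/set0Pn[u uX]] := eqVneq X set0.
  by exists set0; split=> [||u v]; rewrite ?cards0 ?sub0set ?inE.
pose Y := X :\: (u |: [set v in X | bad u v]).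
have sYX : Y \subset X by exact: subsetDl.
have cardY : (#|X| <= #|Y| + D.+1)%N.
  rewrite -(cardsID (u |: [set v in X | bad u v]) X) addnC leq_add2l.
  apply: leq_trans (subset_leq_card (subsetIr _ _)) _.
  by rewrite cardsU1 -add1n leq_add ?badX // leq_b1.
have ltYX : (#|Y| < #|X|)%N.
  apply/proper_card/properP; split=> //.
  by exists u; rewrite // !inE eqxx.
have [||S [sSY leYS indS]] := IHk Y; first exact: leq_trans ltYX _.
  move=> v /(subsetP sYX) vX; apply: leq_trans (badX v vX).
  by apply/subset_leq_card/subsetP => w; rewrite !inE => /andP[/andP[_ ->] ->].
have good v : v \in S -> ~~ bad u v.
  move=> /(subsetP sSY); rewrite !inE negb_or => /andP[/andP[_ bv] vX].
  by rewrite vX in bv.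
have uS : u \notin S by apply/negP => /(subsetP sSY); rewrite !inE eqxx.
exists (u |: S); split.
- by rewrite subUset sub1set uX (subset_trans sSY).
- by rewrite cardsU1 uS mulnDr muln1 addnC; apply: leq_trans cardY _; rewrite leq_add2r.
- move=> v w; rewrite !inE => /orP[/eqP->|vS] /orP[/eqP->|wS] vw.
  + by rewrite eqxx in vw.
  + by rewrite good.
  + by rewrite good // orbT.
  + exact: indS.
Qed.

Section Homogeneous.

Variables (F : fieldType) (n d m N : nat) (pt : 'I_N -> 'rV[F]_n).
Variable q : 'I_m -> 'I_N -> 'rV[F]_N.
Hypothesis d_gt0 : (0 < d)%N.
Hypothesis polyfun_q : forall i u, polyfun pt d (q i u).

(** The color of an edge is determined by the zero pattern of either order of
    its ends, so that fixing one of the two patterns makes a clique. *)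
Definition homogeneous (S : {set 'I_N}) : Prop :=
  exists p : {ffun 'I_m -> bool}, {in S &, forall u v, u != v ->
    [ffun i => q i u 0 v == 0] = p \/ [ffun i => q i v 0 u == 0] = p}.

Let s := flag_degree n d.
Let B := (2 ^ (s.+1 ^ n))%N.
Let C := (m.+1 * 2 ^ m)%N.

(** If some [q i u] that is not zero on [X] has a proportion [1 / r] of zeros
    there, then the dimension can be lowered. Otherwise, among the points
    whose [q i u] vanish on [X] for the same indices [i], the sporadic zeros
    form a sparse relation. *)
Lemma descend_or_homogeneous X r : irreducible pt s X ->
  (0 < r)%N -> (r <= #|X|)%N ->
  (exists S, homogeneous S /\ (r <= C * #|S|)%N) \/
  exists (Y : {set 'I_N}) (g : 'rV[F]_N),
    [/\ Y \subset X, polyfun pt d g, vanishes Y g & ~~ vanishes X g] /\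
    [/\ Y != set0, irreducible pt s Y & (#|X| <= B * r * #|Y|)%N].
Proof.
move=> irrX r0 rX; pose Z i u := [set v in X | q i u 0 v == 0].
have cX : (0 < #|X|)%N by exact: leq_trans rX.
have X0 : X != set0 by rewrite -card_gt0.
have [/existsP[i /existsP[u /andP[qX leXZ]]]|sparse] :=
    boolP [exists i, exists u, ~~ vanishes X (q i u) && (#|X| <= r * #|Z i u|)%N].
  right; have [Y [sYZ irrY leZY]] := irreducible_subset pt s (Z i u).
  have leXY : (#|X| <= B * r * #|Y|)%N.
    apply: leq_trans leXZ _; rewrite -mulnA mulnCA leq_mul2l.
    by apply/orP; right.
  have sZX : Z i u \subset X by apply/subsetP => v; rewrite inE => /andP[].
  exists Y, (q i u); do !split=> //.
  - exact: subset_trans sYZ sZX.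
  - by apply/(vanishesS sYZ)/forall_inP => v; rewrite inE => /andP[].
  - by apply: contraTneq leXY => ->; rewrite cards0 muln0 -ltnNge.
left; pose pat u : {ffun 'I_m -> bool} := [ffun i => vanishes X (q i u)].
have [p leXp] := popular_value pat X0.
set Xp := [set _ in _ | _] in leXp.
have sXpX : Xp \subset X by apply/subsetP => v; rewrite inE => /andP[].
pose bad u v := [exists i, ~~ vanishes X (q i u) && (q i u 0 v == 0)].
have [|S [sSX leXS indS]] :=
    @sparse_independent_set _ bad ((m * #|X|) %/ r) Xp.
  move=> u _; rewrite leq_divRL //.
    apply: (@leq_trans (\sum_(i < m) #|X|)); last by rewrite sum_nat_const card_ord.
  pose bad_i i := [set v in X | ~~ vanishes X (q i u) && (q i u 0 v == 0)].
  apply: (@leq_trans ((\sum_(i < m) #|bad_i i|) * r)).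
    rewrite leq_mul2r; apply/orP; right.
    apply: (@leq_trans #|\bigcup_(i < m) bad_i i|).
      apply/subset_leq_card/subsetP => v; rewrite inE => /andP[/(subsetP sXpX) vX].
      by move=> /existsP[i iv]; apply/bigcupP; exists i; rewrite // inE vX.
    elim/big_ind2: _ => [|A a A' a' leA leA'|i _] //; first by rewrite cards0.
    exact: leq_trans (leq_card_setU _ _) (leq_add leA leA').
  rewrite big_distrl /=; apply: leq_sum => i _.
  move: sparse; rewrite negb_exists => /forallP/(_ i).
  rewrite negb_exists => /forallP/(_ u).
  have [qX _|qX /= ltZX] := boolP (vanishes X (q i u)).
    by rewrite (_ : bad_i i = set0) ?cards0 //; apply/setP => v; rewrite !inE qX andbF.
  rewrite ltnW // ltnNge; apply: contra ltZX; rewrite mulnC => /leq_trans; apply.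
  by rewrite leq_mul2l; apply/orP; right; apply/subset_leq_card/subsetP => v;
    rewrite !inE => /andP[-> /andP[_ ->]].
exists S; split.
  exists p => u v uS vS; have {indS} := indS u v uS vS.
  have patP w x : w \in S -> x \in S -> ~~ bad w x ->
      [ffun i => q i w 0 x == 0] = p.
    move=> /(subsetP sSX); rewrite inE => /andP[_ /eqP <-] /(subsetP sSX).
    rewrite inE => /andP[xX _]; rewrite negb_exists => /forallP nbad.
    apply/ffunP => i; rewrite !ffunE; have := nbad i; rewrite negb_and negbK.
    case: (boolP (vanishes X (q i w))) => [/forall_inP-> //|_ /=].
    exact: negbTE.
  by move=> indS /indS /orP[]; [left|right]; apply: patP.
have cXp : (0 < #|Xp|)%N.
  by rewrite lt0n; apply: contraTneq leXp => ->; rewrite muln0 -ltnNge.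
rewrite -(leq_pmul2r cXp).
apply: leq_trans (leq_mul (leqnn r) leXS) _; rewrite mulnA.
apply: (@leq_trans (m.+1 * #|X| * #|S|)).
  by apply: leq_mul => //; rewrite mulnS mulSn (mulnC r) leq_add // leq_divM.
rewrite [leqRHS]mulnAC leq_mul2r /C -mulnA leq_mul2l.
by move: leXp; rewrite card_ffun card_bool card_ord => ->; rewrite !orbT.
Qed.

(** Each lowering of the dimension costs a factor [B * r]; after [n] of them
    the next one would produce a flag of length [n + 1]. The last factor of
    [(B * r) ^ n.+1] leaves [r] points after the first irreducible subset, which
    costs [B], and the [n] descents. *)
Lemma large_homogeneous r : (0 < r)%N -> ((B * r) ^ n.+1 <= N)%N ->
  exists S, homogeneous S /\ (r <= C * #|S|)%N.
Proof.
move=> r0 rN; have B0 : (0 < B)%N by rewrite expn_gt0.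
have descent k X : irreducible pt s X -> ((B * r) ^ k * r <= #|X|)%N ->
    (exists S, homogeneous S /\ (r <= C * #|S|)%N) \/ flag pt s d k.+1 X.
  have Br0 : (0 < B * r)%N by rewrite muln_gt0 B0.
  elim: k X => [|k IHk] X irrX leX.
    rewrite expn0 mul1n in leX.
    have [|[Y [g [gY [Y0 irrY _]]]]] := descend_or_homogeneous irrX r0 leX.
      by left.
    right; split=> //; first by rewrite -card_gt0; apply: leq_trans leX.
    by exists Y, g; case: gY.
  have rX : (r <= #|X|)%N.
    by apply: leq_trans leX; rewrite leq_pmull // expn_gt0 Br0.
  have [|[Y [g [gY [_ irrY leXY]]]]] := descend_or_homogeneous irrX r0 rX.
    by left.
  have [||flagY] := IHk Y irrY; last 1 first.
  - right; split=> //; first by rewrite -card_gt0; apply: leq_trans rX.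
    by exists Y, g; case: gY.
  - by rewrite -(leq_pmul2l Br0) mulnA -expnS; apply: leq_trans leX leXY.
  - by left.
have [Y [_ irrY leY]] := irreducible_subset pt s [set: 'I_N].
have [|//|/no_long_flag []//] := descent n Y irrY.
rewrite -(leq_pmul2l B0); apply: leq_trans leY; rewrite cardsT card_ord.
by apply: leq_trans rN; rewrite expnS -!mulnA (mulnC _ r).
Qed.

End Homogeneous.

(** * Algebraic colorings *)

(** The partial degrees in the coordinates of the second point are at most the
    total degree. *)
Lemma polyfun_eval2 (F : fieldType) (n N d : nat) (pt : 'I_N -> 'rV[F]_n)
    (f : mpoly.mpoly (n + n) F) (y : 'rV[F]_n) :
  (forall a : mpoly.multinom (n + n),
     a \in mpoly.msupp f -> (mpoly.mdeg a <= d)%N) ->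
  polyfun pt d (\row_x eval2 f y (pt x)).
Proof.
move=> degf; rewrite (_ : \row_x _ = \sum_(a <- mpoly.msupp f)
    (mpoly.mcoeff a f * \prod_i y 0 i ^+ mpoly.fun_of_multinom a (lshift n i)) *:
    \row_x \prod_i pt x 0 i ^+ mpoly.fun_of_multinom a (rshift n i)); last first.
  apply/rowP => x; rewrite !mxE /eval2 mpoly.mevalE summxE.
  apply: eq_bigr => a _; rewrite !mxE big_split_ord /= mulrA.
  congr (_ * _ * _); apply: eq_bigr => i _.
    by rewrite row_mxEl.
  by rewrite row_mxEr.
rewrite big_seq; apply: (big_ind (polyfun pt d)) => [|g h|a af].
- exact: sub0mx.
- exact: polyfunD.
apply/polyfunZ/polyfun_monomial => i.
apply: leq_trans (degf a af).
by rewrite mpoly.mdegE (bigD1 (rshift n i)) //= leq_addr.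
Qed.

(** The exponent [1 / (n + 1)] does not depend on [d] and [m], which enter the
    constant [K] only. *)
Lemma clique_of_algebraic (n d m : nat) : (0 < d)%N ->
  exists2 K : nat, (0 < K)%N &
  forall (t N : nat) (chi : edge_coloring N t), (0 < N)%N ->
  algebraic n d m chi ->
  exists2 S, monochromatic_clique chi S & (N <= (K * #|S|) ^ n.+1)%N.
Proof.
move=> d0; pose B := (2 ^ ((flag_degree n d).+1 ^ n))%N.
pose C := (m.+1 * 2 ^ m)%N.
have B0 : (0 < B)%N by rewrite expn_gt0.
have C0 : (0 < C)%N by rewrite muln_gt0 expn_gt0.
exists (2 * B * C)%N; first by rewrite muln_gt0 C0 andbT muln_gt0.
move=> t N chi N0 [F [pt [f [phi [_ degf chiE]]]]].
pose P r := ((B * r) ^ n.+1 <= N)%N.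
have exP : exists r, P r by exists 0%N; rewrite /P muln0 exp0n.
have ubP r : P r -> (r <= N)%N.
  apply: leq_trans; apply: (@leq_trans (B * r)); first by rewrite leq_pmull.
  have [->|Br0] := posnP (B * r); first by [].
  by rewrite expnS leq_pmulr // expn_gt0 Br0.
have [r Pr maxr] := ex_maxnP exP ubP.
have {maxr} ltN : (N < (B * r.+1) ^ n.+1)%N.
  by rewrite ltnNge; apply/negP => /maxr; rewrite ltnn.
have x0 : 'I_N := Ordinal N0.
(* If r = 0 then N is bounded, and a single vertex is large enough. *)
have [r0|r0] := posnP r.
  exists [set x0].
    exists (chi [set x0; x0]) => u v; rewrite !inE => /eqP-> /eqP->.
    by rewrite eqxx.
  apply: leq_trans (ltnW ltN) _; rewrite r0 cards1 leq_exp2r //.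
  by rewrite !muln1 mulnAC leq_pmull // muln_gt0.
pose q i u := \row_x eval2 (f i) (pt u) (pt x).
have polyfun_q (i : 'I_m) (u : 'I_N) : polyfun pt d (q i u).
  apply: polyfun_eval2 => a af; rewrite -ltnS.
  exact: leq_trans (mpoly.msize_mdeg_lt af) (degf i).
have [S [[p homS] leS]] := large_homogeneous d0 polyfun_q r0 Pr.
exists S.
  exists (phi p) => u v uS vS uv; have patE w x :
      [ffun i => eval2 (f i) (pt w) (pt x) == 0] = [ffun i => q i w 0 x == 0].
    by apply/ffunP => i; rewrite !ffunE mxE.
  have [pE|pE] := homS u v uS vS uv; first by rewrite chiE // patE pE.
  by rewrite setUC chiE ?patE ?pE // eq_sym.
apply: leq_trans (ltnW ltN) _; rewrite leq_exp2r //.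
rewrite -mulnA (mulnC 2) -mulnA leq_mul2l; apply/orP; right.
by rewrite -addn1 mul2n -addnn leq_add // (leq_trans r0).
Qed.

(** For [n, d >= 2] this follows from [ln n <= n] and
    [ln d >= 1 - 1 / d >= 1 / 2]. *)
Lemma min_exponent_ge_half (R : realType) (n d : nat) :
  (0 < n)%N -> (0 < d)%N -> 2^-1 <= min_exponent R n d.
Proof.
move=> n0 d0; have half_le_d : 2^-1 <= d%:R :> R.
  by apply: (@le_trans _ _ 1); [lra|rewrite ler1n].
rewrite /min_exponent; case: ifPn => //.
rewrite negb_or => /andP[n1 d1].
rewrite le_min half_le_d /=.
have n_gt1 : (1 < n)%N by rewrite ltn_neqAle eq_sym n1.
have d_gt1 : (1 < d)%N by rewrite ltn_neqAle eq_sym d1.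
have dR : 2 <= d%:R :> R by rewrite ler_nat.
have lnn_gt0 : 0 < ln n%:R :> R by rewrite ln_gt0 // ltr1n.
have lnn_le : ln n%:R <= n%:R :> R by rewrite ltW // ln_sublinear // ltr0n.
have lnd_ge : 2^-1 <= ln d%:R :> R.
  have dV : d%:R^-1 <= 2^-1 :> R by rewrite lef_pV2 // posrE ltr0n.
  have dV0 : 0 < d%:R^-1 :> R by rewrite invr_gt0 ltr0n.
  have := @le_ln1Dx R (d%:R^-1 - 1); rewrite addrCA subrr addr0.
  rewrite lnV ?posrE ?ltr0n //; lra.
rewrite ler_pdivlMr //; nra.
Qed.

Theorem theorem1p2 (R : realType) :
  exists2 c : R, 0 < c &
  forall n d m : nat, (0 < n)%N -> (0 < d)%N -> (0 < m)%N ->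
  exists2 c' : R, 0 < c' &
  forall t N : nat, (0 < t)%N -> (0 < N)%N ->
  forall chi : edge_coloring N t, algebraic n d m chi ->
  exists2 S : {set 'I_N}, monochromatic_clique chi S &
    let gamma := c * n%:R * m%:R * min_exponent R n d in
    c' * N%:R `^ (1 / gamma) <= #|S|%:R.
Proof.
exists 4 => [|n d m n0 d0 m0]; first by lra.
have [K K0 cliqueK] := clique_of_algebraic n m d0.
have K0R : 0 < K%:R :> R by rewrite ltr0n.
exists K%:R^-1 => [|t N _ N0 chi algchi]; first by rewrite invr_gt0.
have [S cliqueS leN] := cliqueK t N chi N0 algchi.
exists S => //=; set gamma := (X in 1 / X).
have gamma_ge : n.+1%:R <= gamma.
  have e2 := min_exponent_ge_half R n0 d0.
  have nR : 1 <= n%:R :> R by rewrite ler1n.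
  have mR : 1 <= m%:R :> R by rewrite ler1n.
  have nm : n%:R <= n%:R * m%:R :> R by rewrite ler_peMr //; lra.
  rewrite /gamma -natr1 -[4 * _ * _]mulrA; nra.
rewrite mulrC ler_pdivrMr // -natrM mulnC.
have N1 : 1 <= N%:R :> R by rewrite ler1n.
apply: (@le_trans _ _ (N%:R `^ n.+1%:R^-1)).
  rewrite ler_powR // div1r lef_pV2 ?posrE ?ltr0n //.
  by apply: lt_le_trans gamma_ge; rewrite ltr0n.
apply: (@le_trans _ _ (((K * #|S|) ^ n.+1)%:R `^ n.+1%:R^-1)).
  by rewrite ge0_ler_powR ?nnegrE ?invr_ge0 ?ler0n // ler_nat.
rewrite natrX -powR_mulrn ?ler0n // -powRrM divff ?powRr1 ?ler0n //.
by rewrite pnatr_eq0.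
Qed.
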